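(* Let $(\mathcal{S}^x,H)$ be a finite thick skew translation generalized quadrangle of order $(s,t)$ with group of symmetries $\mathbb{S}\le H$ about $x$, and put $T=H/\mathbb{S}$. Suppose that either $s=t$ is odd, or $s\neq t$ and property ( * ) holds. Then the only subgroup $M\le H$ with $M\mathbb{S}=H$ (i.e. projecting onto $T$) is $M=H$.
   Context: A finite generalized quadrangle (GQ) of order $(s,t)$: every line has $s+1$ points, every point is on $t+1$ lines, two points are on at most one common line, and for each point $p$ not on a line $L$ there is a unique point of $L$ collinear with $p$; thick means $s,t>1$. An elation generalized quadrangle $(\mathcal{S}^x,H)$: $H\le\mathrm{Aut}(\mathcal{S})$ fixes every line through $x$ and acts sharply transitively on the points not collinear with $x$. A symmetry about $x$ is an automorphism fixing every point collinear with $x$; the EGQ is a skew translation generalized quadrangle if $H$ contains a subgroup $\mathbb{S}$ of order $t$ of symmetries about $x$ ($\mathbb{S}\trianglelefteq H$). Property ( * ): whenever a point $y\neq x$ collinear with $x$ is fixed by some element $h\in H$, then $h$ fixes every point of the line $xy$. *)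

(* Defs.v *)
From mathcomp Require Import all_boot all_order all_fingroup.
Set Implicit Arguments. Unset Strict Implicit. Unset Printing Implicit Defensive.

Section GQ.
Variables (P L : finType) (inc : P -> L -> bool).

Definition collinear (p q : P) : bool := [exists l, inc p l && inc q l].

Definition is_GQ (s t : nat) : Prop :=
  [/\ forall l : L, #|[set p | inc p l]| = s.+1,
      forall p : P, #|[set l | inc p l]| = t.+1,
      forall p q : P, p != q -> #|[set l | inc p l && inc q l]| <= 1
    & forall (p : P) (l : L), ~~ inc p l ->
        #|[set q | inc q l && collinear p q]| = 1].

Definition thick_GQ (s t : nat) : Prop := [/\ is_GQ s t, 1 < s & 1 < t].

(* Automorphisms (collineations): permutations of points mapping every line
   (as a point set) onto a line. Lines of a GQ are determined by their points. *)
Definition Aut_GQ : {set {perm P}} :=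
  [set g : {perm P} | [forall l, exists l', forall p, inc (g p) l' == inc p l]].

Definition fixes_line (g : {perm P}) (l : L) : bool :=
  [forall p, inc (g p) l == inc p l].

Definition is_EGQ (s t : nat) (x : P) (H : {group {perm P}}) : Prop :=
  [/\ is_GQ s t, H \subset Aut_GQ,
      forall h, h \in H -> forall l, inc x l -> fixes_line h l
    & forall y z, ~~ collinear x y -> ~~ collinear x z ->
        #|[set h in H | h y == z]| = 1].

Definition symmetry_about (x : P) (g : {perm P}) : bool :=
  (g \in Aut_GQ) && [forall y, collinear x y ==> (g y == y)].

Definition is_STGQ (s t : nat) (x : P) (H S : {group {perm P}}) : Prop :=
  [/\ is_EGQ s t x H, S \subset H, (S <| H)%g, #|S| = t
    & forall g, g \in S -> symmetry_about x g].

Definition property_star (x : P) (H : {group {perm P}}) : Prop :=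
  forall y, y != x -> collinear x y ->
  forall h, h \in H -> h y = y ->
  forall l, inc x l -> inc y l -> forall z, inc z l -> h z = z.

End GQ.

(* Main.v *)
Require Import Defs.
From mathcomp Require Import all_boot all_order all_fingroup.
From mathcomp Require Import all_algebra all_solvable all_field.
From mathcomp Require Import ring zify.
Set Implicit Arguments. Unset Strict Implicit. Unset Printing Implicit Defensive.
Import GRing.Theory Num.Theory.

(** Fix a point y0 not collinear with x. For a line k through x, let z k be the point
    of k collinear with y0, A k the stabilizer in H of the line y0 (z k), and
    B k = A k S the stabilizer of z k; these have orders s and st in the group H of
    order s^2 t, and B i meets A j trivially for i <> j. The hypotheses force all
    B k to be normal in H, so H / S, being generated by any two of at least three
    pairwise commuting B k / S, is abelian.

    Let h lie in B k but not in S. If no conjugate of h were in A k, Benson's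
    congruence for the fixed and collinearly moved points of h would say that s + t
    divides st, which is impossible: clearly so for s = t odd, and for s <> t because
    t is at most the p-part of s for each prime p dividing s (count the p-parts of
    the subgroups B k / S of H / S). So h and all elements of h S are conjugate to
    the unique element of A k in h S; the class of h is h S and its centralizer has
    order s^2.

    Suppose M S = H and put U = M :&: S. For m in M :&: B k outside S, the M-class of
    m lies in m U, so the centralizer of m in M has order at least s^2 and equals its
    centralizer in H. Hence no element of S outside M commutes with such an m, and
    M :&: B k, of order s |U|, acts on S :\: M with orbits of length at least s; as
    |S| = t <= s this is only possible if S is contained in M. *)

(** * Benson's congruence *)

Section MatrixTrace.
Local Open Scope ring_scope.

(** Each eigenvalue satisfies [z ^+ k.+1 = z], so it is 0 or a root of unity, and the trace is the
    sum of the eigenvalues. Singular matrices must be allowed: the use is for a permutation matrix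
    times an idempotent. *)
Lemma mxtrace_Aint n (M : 'M[algC]_n) k : (0 < k)%N -> M ^+ k.+1 = M -> \tr M \in Aint.
Proof.
move=> k0 Mk; case: (posnP n) => [n0|n0].
  by rewrite /mxtrace big1 ?rpred0 // => i _; have := ltn_ord i; rewrite [X in (_ < X)%N]n0.
have [r Er] := closed_field_poly_normal (char_poly M).
move: Er; rewrite (monicP (char_poly_monic M)) scale1r => Er.
have sr : size r = n.
  by apply/succn_inj; rewrite -(size_char_poly M) Er size_prod_XsubC.
have := char_poly_trace M n0; rewrite Er -{1}sr coefPn_prod_XsubC ?sr -?lt0n //.
move/oppr_inj <-; rewrite big_seq; apply: rpred_sum => z rz.
have : eigenvalue M z by rewrite eigenvalue_root_char Er root_prod_XsubC.
case/eigenvalueP=> v vM v0.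
have vX j : v *m M ^+ j = z ^+ j *: v.
  elim: j => [|j IH]; first by rewrite !expr0 mulmx1 scale1r.
  by rewrite exprSr mulmxA IH -scalemxAl vM scalerA exprSr.
have zk : z ^+ k.+1 = z.
  have := vX k.+1; rewrite Mk vM => /eqP; rewrite -subr_eq0 -scalerBl scaler_eq0.
  by rewrite (negbTE v0) orbF subr_eq0 => /eqP.
case: (eqVneq z 0) => [->|z0]; first exact: rpred0.
apply: (@Aint_unity_root k) => //; apply/unity_rootP.
by apply: (mulfI z0); rewrite -exprS zk mulr1.
Qed.

End MatrixTrace.

(** * Matrices indexed by the points, given by functions of two points *)

Section KernelMatrix.
Local Open Scope ring_scope.
Variables (P : finType) (R : comNzRingType).
Implicit Types f g : P -> P -> R.

Definition kernel_mx f : 'M[R]_#|P| := \matrix_(i, j) f (enum_val i) (enum_val j).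

Lemma sum_enum_val (F : P -> R) : \sum_(i < #|P|) F (enum_val i) = \sum_p F p.
Proof. by rewrite -big_enum_val. Qed.

Lemma eq_kernel_mx f g : f =2 g -> kernel_mx f = kernel_mx g.
Proof. by move=> fg; apply/matrixP=> i j; rewrite !mxE. Qed.

Lemma kernel_mxM f g :
  kernel_mx f *m kernel_mx g = kernel_mx (fun p q => \sum_r f p r * g r q).
Proof.
apply/matrixP=> i j; rewrite !mxE -sum_enum_val.
by apply: eq_bigr => k _; rewrite !mxE.
Qed.

Lemma kernel_mx1 : kernel_mx (fun p q => (p == q)%:R) = 1.
Proof. by apply/matrixP=> i j; rewrite !mxE (inj_eq enum_val_inj). Qed.

Lemma mxtrace_kernel f : \tr (kernel_mx f) = \sum_p f p p.
Proof. by rewrite -sum_enum_val; apply: eq_bigr => i _; rewrite mxE. Qed.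

End KernelMatrix.

(** * The collinearity matrix of a generalized quadrangle and its quadratic equation *)

Section Benson.
Variables (P L : finType) (inc : P -> L -> bool) (s t : nat).
Hypothesis gq : is_GQ inc s t.

(** As a matrix this is the incidence matrix times its transpose. In the sum of [joins p (h p)], a
    fixed point weighs [t.+1] and a point moved to a collinear one weighs 1. *)
Definition joins (p q : P) : nat := #|[set l | inc p l && inc q l]|.

Lemma joins_sum p q : joins p q = \sum_l inc p l * inc q l.
Proof.
rewrite /joins -sum1_card big_mkcond; apply: eq_bigr => l _.
by rewrite inE; case: (inc p l); case: (inc q l).
Qed.

Lemma joinsC p q : joins p q = joins q p.
Proof. by apply: eq_card => l; rewrite !inE andbC. Qed.

Lemma joins_diag p : joins p p = t.+1.
Proof.
by case: gq => _ /(_ p) <- _ _; apply: eq_card => l; rewrite !inE andbb.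
Qed.

Lemma joins_neq p q : p != q -> joins p q = collinear inc p q.
Proof.
move=> pq; case: gq => _ _ /(_ p q pq) le1 _.
case: (boolP (collinear inc p q)) => [/existsP[l pql]|no].
  apply/eqP; rewrite eqn_leq le1 card_gt0; apply/set0Pn.
  by exists l; rewrite inE.
apply/eqP; rewrite cards_eq0; apply/eqP/setP=> l; rewrite !inE.
by apply: contraNF no => pql; apply/existsP; exists l.
Qed.

Lemma sum_inc l : \sum_p inc p l = s.+1.
Proof.
case: gq => /(_ l) <- _ _ _; rewrite -sum1_card [RHS]big_mkcond.
by apply: eq_bigr => p _; rewrite inE; case: inc.
Qed.

Lemma sum_joins p : \sum_q joins p q = s.+1 * t.+1.
Proof.
under eq_bigr do rewrite joins_sum.
rewrite exchange_big /= -(joins_diag p) joins_sum big_distrr /=.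
apply: eq_bigr => l _; rewrite -big_distrr /= sum_inc.
by case: inc; lia.
Qed.

(** The projection axiom in matrix form. If [p] is on [l], then [p] itself contributes [t.+1] and
    each of the other [s] points contributes 1. *)
Lemma sum_inc_joins p l :
  \sum_r inc r l * joins p r = 1 + (s + t) * inc p l.
Proof.
case: gq => hl _ _ hpl.
case: (boolP (inc p l)) => [pl|pl].
  rewrite (bigD1 p) //= pl joins_diag.
  rewrite (eq_bigr (fun r => inc r l : nat)); last first.
    move=> r rp; case: (boolP (inc r l)) => //= rl; rewrite joins_neq 1?eq_sym //.
    by rewrite (_ : collinear inc p r) //; apply/existsP; exists l; rewrite pl.
  by have := sum_inc l; rewrite (bigD1 p) //= pl; lia.
rewrite muln0 addn0 -[RHS](hpl p l pl) -sum1_card [RHS]big_mkcond.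
apply: eq_bigr => r _; rewrite inE; case: (boolP (inc r l)) => //= rl.
by rewrite joins_neq ?mul1n; [case: collinear | apply: contraNneq pl => ->].
Qed.

(** Expanding [joins r q] over the lines through [q] reduces this to [sum_inc_joins] on each such
    line. *)
Lemma sum_joins_joins p q :
  \sum_r joins p r * joins r q = t.+1 + (s + t) * joins p q.
Proof.
under eq_bigr => r _ do rewrite (joins_sum r) big_distrr /=.
rewrite exchange_big /=.
rewrite (eq_bigr (fun l => inc q l * inc q l + (s + t) * (inc p l * inc q l))).
  by rewrite big_split /= -big_distrr /= -!joins_sum joins_diag.
move=> l _; transitivity ((\sum_r inc r l * joins p r) * inc q l); last first.
  by rewrite sum_inc_joins; case: (inc q l); case: (inc p l); lia.
by rewrite big_distrl /=; apply: eq_bigr => r _; lia.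
Qed.

(** Count by summing [sum_joins_joins] over [q]: the square of [(s+1)(t+1)] equals
    [(t+1) #|P| + (s+t)(s+1)(t+1)]. *)
Lemma card_points (p : P) : #|P| = s.+1 * (s * t).+1.
Proof.
have : \sum_q \sum_r joins p r * joins r q = \sum_q (t.+1 + (s + t) * joins p q).
  by apply: eq_bigr => q _; apply: sum_joins_joins.
rewrite exchange_big /= (eq_bigr (fun r => joins p r * (s.+1 * t.+1))); last first.
  by move=> r _; rewrite -big_distrr /= sum_joins.
rewrite -big_distrl /= sum_joins big_split /= -big_distrr /= sum_joins sum_nat_const.
rewrite [#|_|](_ : _ = #|P|) //; nia.
Qed.

Section Automorphism.
Variable h : {perm P}.
Hypothesis hcol : forall p q, collinear inc (h p) (h q) = collinear inc p q.

Lemma joins_perm p q : joins (h p) (h q) = joins p q.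
Proof.
case: (eqVneq p q) => [->|pq]; first by rewrite !joins_diag.
by rewrite !joins_neq ?hcol // (inj_eq perm_inj).
Qed.

(* N := joins satisfies N^2 = (s + t) N + (t + 1) J, so
   E := (N - c J) / (s + t) with c = (t + 1) / (st + 1) is idempotent; as h commutes
   with E, the trace of h E is an algebraic integer, and it is rational. *)
Lemma benson (x : P) : 0 < s -> \sum_p joins p (h p) = s.+1 * t.+1 %[mod s + t].
Proof.
move=> s_gt0; pose v : algC := (#|P|%:R)%R; pose S : algC := ((s + t)%:R)%R.
pose J := kernel_mx (fun _ _ : P => 1 : algC)%R.
pose N := kernel_mx (fun p q => (joins p q)%:R : algC)%R.
pose Q := kernel_mx (fun p q => (q == h p)%:R : algC)%R.
pose kap : algC := (s.+1 * t.+1)%:R%R.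
pose c : algC := (t.+1%:R / (s * t).+1%:R)%R.
pose E := (S^-1 *: (N - c *: J))%R.
have Qsum (F : P -> algC) p : (\sum_r (r == h p)%:R * F r = F (h p))%R.
  rewrite (bigD1 (h p)) //= eqxx mul1r big1 ?addr0 // => r /negbTE->.
  by rewrite mul0r.
have QJ : (Q *m J = J)%R.
  by rewrite kernel_mxM; apply: eq_kernel_mx => p q; rewrite (Qsum (fun=> 1%R)).
have JQ : (J *m Q = J)%R.
  rewrite kernel_mxM; apply: eq_kernel_mx => p q.
  rewrite (bigD1 ((h^-1)%g q)) //= permKV eqxx mul1r big1 ?addr0 // => r rq.
  by case: (q =P h r) => [qE|_]; [rewrite qE permK eqxx in rq | rewrite mulr0].
have QN : (Q *m N = N *m Q)%R.
  rewrite !kernel_mxM; apply: eq_kernel_mx => p q.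
  rewrite (Qsum (fun r => (joins r q)%:R%R)).
  rewrite (bigD1 ((h^-1)%g q)) //= permKV eqxx mulr1 big1 ?addr0; last first.
    move=> r rq; case: (q =P h r) => [qE|_]; last by rewrite mulr0.
    by rewrite qE permK eqxx in rq.
  by rewrite -{1}(permKV h q) joins_perm.
have NJ : (N *m J = kap *: J)%R.
  rewrite kernel_mxM; apply/matrixP=> i j; rewrite !mxE mulr1.
  under eq_bigr do rewrite mulr1.
  by rewrite -natr_sum sum_joins.
have JN : (J *m N = kap *: J)%R.
  rewrite kernel_mxM; apply/matrixP=> i j; rewrite !mxE mulr1.
  under eq_bigr do rewrite mul1r joinsC.
  by rewrite -natr_sum sum_joins.
have JJ : (J *m J = v *: J)%R.
  rewrite kernel_mxM; apply/matrixP=> i j; rewrite !mxE mulr1.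
  under eq_bigr do rewrite mulr1.
  by rewrite sumr_const.
have NN : (N *m N = t.+1%:R *: J + S *: N)%R.
  rewrite kernel_mxM; apply/matrixP=> i j; rewrite !mxE mulr1.
  under eq_bigr do rewrite -natrM.
  by rewrite -natr_sum sum_joins_joins natrD natrM.
have S0 : (S != 0)%R by rewrite pnatr_eq0; lia.
have st0 : ((s * t).+1%:R != 0 :> algC)%R by rewrite pnatr_eq0.
have Ev : v = ((s%:R + 1) * (s%:R * t%:R + 1))%R.
  by rewrite /v (card_points x) natrM -!natr1 natrM.
have ES : S = (s%:R + t%:R)%R by rewrite /S natrD.
have Ek : kap = ((s%:R + 1) * (t%:R + 1))%R by rewrite /kap natrM -!natr1.
have Ec : c = ((t%:R + 1) / (s%:R * t%:R + 1))%R by rewrite /c -!natr1 natrM.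
rewrite -natr1 natrM in st0; rewrite ES in S0.
(* Since [c v = kap], comparing the coefficients of [J] leaves the identity
   [t + 1 = c (kap - s - t)]. *)
have EE : (E *m E = E)%R.
  rewrite /E -scalemxAl -scalemxAr mulmxBl !mulmxBr -!(scalemxAl, scalemxAr).
  rewrite NN NJ JN JJ; apply/matrixP=> i j; rewrite !mxE Ec Ek Ev ES -natr1.
  by field; rewrite S0 st0.
have QE : (Q *m E = E *m Q)%R.
  by rewrite /E -scalemxAl -scalemxAr mulmxBl mulmxBr -!(scalemxAl, scalemxAr) QJ JQ QN.
have QX k : (Q ^+ k = kernel_mx (fun p q => (q == iter k h p)%:R))%R.
  elim: k => [|k IH].
    by rewrite expr0 -(kernel_mx1 P); apply: eq_kernel_mx => p q; rewrite eq_sym.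
  rewrite exprS IH [(_ * _)%R]kernel_mxM; apply: eq_kernel_mx => p q.
  by rewrite (Qsum (fun r => (q == iter k h r)%:R%R)) -iterSr.
have EX k : (E ^+ k.+1 = E)%R.
  by elim: k => [|k IH]; rewrite ?expr1 // exprS IH; apply: EE.
(* [Q] and [E] commute, [E] is idempotent and [Q ^+ #[h] = 1], so raising [Q * E] to the power
   [#[h].+1] gives it back. *)
have Aint_tr : (\tr (Q * E) \in Aint)%R.
  apply: (@mxtrace_Aint _ _ #[h]%g); first exact: order_gt0.
  rewrite exprMn_comm // EX exprS QX (@eq_kernel_mx _ _ _ (fun p q => (p == q)%:R)%R).
    by rewrite kernel_mx1 mulr1.
  by move=> p q; rewrite -permX expg_order perm1 eq_sym.
(* The trace of [c J] is [c v = kap], so integrality of this trace is exactly the desired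
   congruence. *)
have tr_eq : (\tr (Q * E) = ((\sum_p joins p (h p))%:R - kap) / S)%R.
  have -> : (Q * E = S^-1 *: (Q *m N - c *: J))%R.
    by rewrite -[LHS]/(_ *m _)%R /E -scalemxAr mulmxBr -scalemxAr QJ.
  rewrite mxtraceZ linearB /= mxtraceZ kernel_mxM !mxtrace_kernel.
  rewrite (eq_bigr (fun p => (joins p (h p))%:R)%R); last first.
    by move=> p _; rewrite (Qsum (fun r => (joins r p)%:R%R)) joinsC.
  rewrite sumr_const -/v natr_sum Ev Ec Ek ES.
  by field; rewrite S0 st0.
have /intrP[m Em] : (\tr (Q * E) \is a Num.int)%R.
  apply: Cint_rat_Aint Aint_tr; rewrite tr_eq.
  by rewrite rpred_div ?rpredB ?rpred_nat.
have : ((\sum_p joins p (h p))%:R - kap = (m * (s + t)%:Z)%:~R)%R.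
  rewrite intrM -Em tr_eq -pmulrn mulfVK // -/S ES //.
rewrite /kap !pmulrn -intrB => /intr_inj E'.
apply/eqP; rewrite -eqz_nat -!modz_nat eqz_mod_dvd E'.
exact: dvdz_mull.
Qed.

End Automorphism.
End Benson.

(** * Skew families of subgroups *)

Import GroupScope.

Lemma card_disjoint_bigcup (I T : finType) (F : I -> {set T}) :
  (forall i j, i != j -> [disjoint F i & F j]) ->
  #|\bigcup_i F i| = (\sum_i #|F i|)%N.
Proof.
move=> dF; rewrite -sum1_card partition_disjoint_bigcup //.
by apply: eq_bigr => i _; rewrite sum1_card.
Qed.

Lemma not_dvdn_add_mul (s t : nat) : (0 < s)%N -> (0 < t)%N -> s != t ->
  (forall p, prime p -> (p %| s)%N -> (t <= s`_p)%N) ->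
  ~~ (s + t %| s * t)%N.
Proof.
move=> s0 t0 st tp; apply/negP=> dv.
have d0 : (0 < gcdn s t)%N by rewrite gcdn_gt0 s0.
move: (dvdn_gcdl s t) (dvdn_gcdr s t) => /dvdnP [s' Es] /dvdnP [t' Et].
set d := gcdn s t in d0 Es Et.
have cop : coprime s' t'.
  rewrite /coprime -(eqn_pmul2r d0) muln_gcdl -Es -Et mul1n; exact: eqxx.
clearbody d; have dvd : (s' + t' %| d)%N.
  have : (s' + t' %| d * (s' * t'))%N.
    rewrite -(dvdn_pmul2r d0) mulnDl -Es -Et; move: dv; rewrite {2}Es {2}Et.
    by rewrite (_ : (s' * d * (t' * d) = d * (s' * t') * d)%N) //; lia.
  rewrite Gauss_dvdl // coprimeMr.
  have copC : coprime t' s' by rewrite coprime_sym.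
  by rewrite ![coprime (_ + _) _]coprime_sym /coprime gcdnDl gcdnDr -/(coprime _ _) cop.
have s'0 : (0 < s')%N by move: s0; rewrite Es muln_gt0 => /andP[].
have t'0 : (0 < t')%N by move: t0; rewrite Et muln_gt0 => /andP[].
have [p pr_p pd] : exists2 p, prime p & (p %| s' + t')%N.
  by exists (pdiv (s' + t')); rewrite ?pdiv_prime ?pdiv_dvd // -(addn1 1) leq_add.
have pnt : ~~ (p %| t')%N.
  apply/negP=> pt; have ps : (p %| s')%N by rewrite -(dvdn_addl _ pt).
  have : (p %| gcdn s' t')%N by rewrite dvdn_gcd ps.
  by rewrite (eqP cop) dvdn1 => /eqP p1; rewrite p1 in pr_p.
have pns : ~~ (p %| s')%N.
  by apply: contra pnt => ps; rewrite -(dvdn_addr _ ps).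
have part (m : nat) : (0 < m)%N -> ~~ (p %| m)%N -> ((m * d)`_p = d`_p)%N.
  move=> m0 pm; rewrite partnM // (_ : m`_p = 1)%N ?mul1n //.
  by apply/eqP; rewrite p_part_eq1 // mem_primes pr_p m0.
have tsp : (t <= d`_p)%N.
  rewrite -(part s') // -Es; apply: tp => //.
  by rewrite Es dvdn_mull // (dvdn_trans pd dvd).
have dt : d = t.
  apply/eqP; rewrite eqn_leq {1}Et leq_pmull //=; apply: leq_trans tsp _.
  by apply: dvdn_leq; rewrite // dvdn_part.
have t'1 : t' = 1%N by apply/eqP; rewrite -(eqn_pmul2r d0) -Et mul1n dt.
have s'2 : (1 < s')%N.
  by rewrite ltn_neqAle s'0 andbT; apply: contra st => /eqP E; rewrite Es -E dt mul1n.
(* A prime divisor of [s'] differs from [p], so its part of [s] comes from [s'] alone. This bounds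
   [t] by [s'], against [s' + 1 <= t]. *)
have tq : (t <= s`_(pdiv s'))%N.
  by apply: tp; rewrite ?pdiv_prime // Es dvdn_mulr // pdiv_dvd.
have prq := pdiv_prime s'2.
have tpow : (t = t`_p)%N.
  by apply/eqP; rewrite eqn_leq -{1 2}dt {1}dt tsp dvdn_leq ?dvdn_part.
have qt : (t`_(pdiv s') = 1)%N.
  apply/eqP; rewrite p_part_eq1 // tpow; apply/negP; rewrite mem_primes => /and3P[_ _].
  rewrite p_part Euclid_dvdX // => /andP[].
  rewrite dvdn_prime2 // => /eqP E _; move: pns; rewrite -E.
  by rewrite pdiv_dvd.
move: tq; rewrite Es dt partnM // qt muln1 => tq.
have le_d : (s' + t' <= d)%N by apply: dvdn_leq.
have le_s' : (s'`_(pdiv s') <= s')%N by apply: dvdn_leq; rewrite // dvdn_part.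
have := leq_trans le_d (leq_trans _ le_s'); rewrite dt t'1 addn1 => /(_ tq).
by rewrite ltnn.
Qed.

(** * Kantor families whose tangent groups all contain a normal subgroup [S] *)

Section SkewFamily.

Variables (gT : finGroupType) (I : finType) (H S : {group gT}).
Variables (A B : I -> {group gT}) (s t : nat).
Hypotheses (s_gt1 : (1 < s)%N) (t_gt1 : (1 < t)%N) (cardI : #|I| = t.+1).
Hypotheses (nSH : S <| H) (oH : #|H| = (s * s * t)%N) (oS : #|S| = t).
Hypotheses (oA : forall i, #|A i| = s) (oB : forall i, #|B i| = (s * t)%N).
Hypotheses (sAB : forall i, A i \subset B i) (sSB : forall i, S \subset B i).
Hypotheses (sBH : forall i, B i \subset H).
Hypothesis (tiBA : forall i j, i != j -> B i :&: A j = 1).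

Lemma other_index (i j : I) : exists k, (k != i) && (k != j).
Proof.
apply/existsP; apply: contraT; rewrite negb_exists => /forallP none.
have : #|[set: I]| <= #|[set i; j]|.
  by apply/subset_leq_card/subsetP => k _; rewrite !inE; move: (none k); rewrite negb_and !negbK.
by rewrite cardsT cardI cards2; case: (i != j); rewrite ltnNge ?t_gt1 ?(ltnW t_gt1).
Qed.

Lemma skew_tiAS i : A i :&: S = 1.
Proof.
have [j /andP[ji _]] := other_index i i.
by apply/trivgP; rewrite -(tiBA ji) setIC setIS.
Qed.

Lemma skew_prodAS i : A i * S = B i.
Proof.
apply/eqP; rewrite eqEcard mul_subG //= oB.
by rewrite (TI_cardMg (skew_tiAS i)) oA oS.
Qed.

(** By the modular law, since [B j = A j S] and [S] lies in [B i]. *)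
Lemma skew_tiBB i j : i != j -> B i :&: B j = S.
Proof.
move=> ij; rewrite -(skew_prodAS j).
by rewrite -group_modr // tiBA // mul1g.
Qed.

Lemma skew_prodBB i j : i != j -> B i * B j = H.
Proof.
move=> ij; apply/eqP; rewrite eqEcard mul_subG //=.
have tiB := tiBA ij.
apply: leq_trans (subset_leq_card (mulgS (B i) (sAB j))).
by rewrite (TI_cardMg tiB) oB oA oH; lia.
Qed.

(* For s = t the cosets of the B i form the lines of an affine plane on H / S on
   which H acts by fixed-point-free dilatations; two nonparallel fixed lines of h
   would meet in a fixed point. *)
Lemma skew_normal_square : s = t -> forall i, B i <| H.
Proof.
move=> st i; have sSH := normal_sub nSH.
(* The [t + 1] disjoint sets [B j :\: S] have [st - t] elements each; for [s = t] this adds up to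
   [#|H| - #|S|]. *)
have cover : H :\: S \subset \bigcup_j (B j :\: S).
  have sub : \bigcup_j (B j :\: S) \subset H :\: S.
    by apply/bigcupsP=> j _; rewrite setSD.
  have : \bigcup_j (B j :\: S) == H :\: S; last by move/eqP->.
  rewrite eqEcard sub card_disjoint_bigcup /=; last first.
    move=> j k jk; rewrite -setI_eq0 -setDIl; have -> := skew_tiBB jk.
    by rewrite setDv.
  rewrite (eq_bigr (fun=> (s * t - t)%N)); last first.
    by move=> j _; rewrite cardsDS // oB oS.
  by rewrite sum_nat_const cardsDS // oH oS [#|_|]cardI st mulnBr; lia.
rewrite /normal sBH; apply/subsetP=> g Hg; rewrite inE; apply/subsetP=> _ /imsetP[h Bh ->].
case: (boolP (h \in S)) => [Sh|Sh].
  by apply: (subsetP (sSB i)); rewrite memJ_norm // (subsetP (normal_norm nSH)).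
have HSg : h ^ g \in H :\: S.
  rewrite inE memJ_norm ?(subsetP (normal_norm nSH)) // Sh groupJ //.
  exact: subsetP (sBH i) _ _.
have /bigcupP[j _] := subsetP cover _ HSg; rewrite inE => /andP[_ Bj].
case: (eqVneq i j) => [->//|ij].
(* With [g = b c], the element [h ^ b] lies in [B i], and in [B j] because [h ^ g] and [c] do; this
   forces [h] into [S]. *)
move: Hg; rewrite -(skew_prodBB ij) => /mulsgP[b c Bb Bc E].
have : h ^ b \in B i :&: B j.
  rewrite inE groupJ //= (_ : h ^ b = (h ^ g) ^ c^-1).
    by rewrite groupJ // groupV.
  by rewrite E -conjgM mulgK.
rewrite skew_tiBB // memJ_norm ?(negbTE Sh) //.
by apply: (subsetP (normal_norm nSH)); apply: subsetP (sBH i) _ _.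
Qed.

Hypothesis nB : forall i, B i <| H.

(** For [i != j] normality puts the commutators of [B i] and [B j] into their intersection [S]. So
    [B i / S] commutes with two other members, which generate [H / S], and is central. *)
Lemma skew_quotient_abelian : abelian (H / S).
Proof.
have nSB i : B i \subset 'N(S) by apply: subset_trans (normal_norm nSH).
have cBB i j : i != j -> B i / S \subset 'C(B j / S).
  move=> ij; rewrite quotient_cents2 // -(skew_tiBB ij).
  by apply: commg_subI; rewrite subsetI subxx (subset_trans (sBH _)) ?normal_norm.
have cBH i : B i / S \subset 'C(H / S).
  have [j /andP[ji _]] := other_index i i.
  have [k /andP[ki kj]] := other_index i j.
  rewrite -(skew_prodBB kj) quotientMl // centM subsetI.
  by rewrite !cBB // eq_sym.
have /card_gt0P[i0 _] : (0 < #|I|)%N by rewrite cardI.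
have [j /andP[ji _]] := other_index i0 i0.
by rewrite /abelian -{1}(skew_prodBB ji) quotientMl // mul_subG.
Qed.

Lemma skew_leq_part p : prime p -> (p %| s)%N -> (t <= s`_p)%N.
Proof.
move=> pr_p ps.
have s0 : (0 < s)%N by lia.
have t0 : (0 < t)%N by lia.
have nSB i : B i \subset 'N(S) by apply: subset_trans (normal_norm nSH).
have abT := skew_quotient_abelian.
have sBT i : B i / S \subset H / S by apply: quotientS.
have oT : #|H / S| = (s * s)%N.
  by rewrite card_quotient ?normal_norm // -divgS ?normal_sub // oH oS mulnK.
have oBS i : #|B i / S| = s.
  by rewrite card_quotient // -divgS // oB oS mulnK.
have oOp (G : {group coset_of S}) : G \subset H / S -> (#|'O_p(G)| = #|G|`_p)%N.
  move=> sG; apply: card_Hall; apply: nilpotent_pcore_Hall.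
  by apply/abelian_nil/(abelianS sG).
have sO i : 'O_p(B i / S) \subset 'O_p(H / S).
  apply: pcore_max; first exact: pcore_pgroup.
  rewrite -(sub_abelian_normal _ abT).
  by apply: subset_trans (sBT i); apply: pcore_sub.
have sU : \bigcup_i ('O_p(B i / S)^#) \subset 'O_p(H / S)^#.
  by apply/bigcupsP=> i _; rewrite setSD.
have := subset_leq_card sU; rewrite card_disjoint_bigcup; last first.
  move=> i j ij; rewrite -setI_eq0 -setDIl setD_eq0.
  apply: subset_trans (_ : B i / S :&: B j / S \subset _).
    by apply: setISS; apply: pcore_sub.
  by rewrite -quotientGI // skew_tiBB // quotient_sub1.
rewrite (eq_bigr (fun=> (s`_p - 1)%N)); last first.
  by move=> i _; rewrite cardsDS ?sub1G // oOp //= oBS cards1.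
rewrite sum_nat_const cardsDS ?sub1G // oOp //= oT cards1 partnM // [#|_|]cardI.
have : (1 < s`_p)%N by rewrite p_part_gt1 mem_primes pr_p s0.
move: (s`_p)%N => q q1 le; rewrite -ltnS -(leq_pmul2r (_ : 0 < q - 1)%N) ?subn_gt0 //.
apply: leq_trans le _; rewrite mulnBr muln1; lia.
Qed.

Hypothesis le_ts : (t <= s)%N.
Hypothesis conjA : forall i h, h \in B i -> h \notin S ->
  exists2 g, g \in H & h ^ g \in A i.

(* Conjugation moves h inside h S, and A i meets h S in a single element. *)
Lemma skew_lcoset_sub_class i h : h \in B i -> h \notin S -> h *: S \subset h ^: H.
Proof.
move=> Bh Sh; have Hh : h \in H := subsetP (sBH i) h Bh.
have sSH := normal_sub nSH.
have nSHs : H \subset 'N(S) := normal_norm nSH.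
have sder : [~: H, H] \subset S by rewrite -quotient_cents2 //; apply: skew_quotient_abelian.
have conjS x y : x \in H -> y \in H -> x^-1 * x ^ y \in S.
  by move=> Hx Hy; apply: (subsetP sder); apply: mem_commg.
apply/subsetP=> _ /lcosetP[k Sk ->].
have Hk := subsetP sSH k Sk.
have Bhk : h * k \in B i by rewrite groupM // (subsetP (sSB i)).
have Shk : h * k \notin S by rewrite groupMr.
have [g Hg Ag] := conjA Bhk Shk.
have [g' Hg' Ag'] := conjA Bh Sh.
(* Both conjugates lie in [A i] and are congruent modulo [S], which contains the derived group and
   [k]; hence they coincide. *)
have E : (h ^ g')^-1 * (h * k) ^ g \in A i :&: S.
  rewrite inE groupM ?groupV //=.
  have -> : (h ^ g')^-1 * (h * k) ^ g =
     (h^-1 * h ^ g')^-1 * k * ((h * k)^-1 * (h * k) ^ g).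
    by rewrite !invMg !mulgA !mulgK !mulgKV.
  apply: groupM; last by apply: conjS; rewrite // groupM.
  by apply: groupM => //; rewrite groupV conjS.
move: E; rewrite skew_tiAS => /set1P /(canRL (mulKVg _)); rewrite mulg1 => E.
apply/imsetP; exists (g' * g^-1); first by rewrite groupM ?groupV.
by rewrite conjgM -E conjgK.
Qed.

(** The class of [h] has at least [#|S| = t] elements, by [skew_lcoset_sub_class]. *)
Lemma skew_card_cent1 i h : h \in B i -> h \notin S -> (#|'C_H[h]| <= s * s)%N.
Proof.
move=> Bh Sh; have := subset_leq_card (skew_lcoset_sub_class Bh Sh).
rewrite card_lcoset -index_cent1 oS => le.
have := Lagrange (subsetIl H 'C[h]); rewrite oH => L.
by rewrite -(leq_pmul2r (_ : 0 < t)%N) ?(ltnW t_gt1) // -L leq_mul2l le orbT.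
Qed.

(* C_H(m) <= M for every m in M :&: B i outside S, so M :&: B i acts on S :\: M with
   orbits of length at least s >= t. *)
Lemma skew_supplement (M : {group gT}) : M \subset H -> M * S = H -> M = H :> {set gT}.
Proof.
move=> sMH MS; have t0 : (0 < t)%N := ltnW t_gt1.
have sSH := normal_sub nSH.
have /card_gt0P[i _] : (0 < #|I|)%N by rewrite cardI.
pose N := M :&: B i; pose U := M :&: S.
have u0 : (0 < #|U|)%N by apply: cardG_gt0.
have oM : #|M| = (s * s * #|U|)%N.
  apply/eqP; rewrite -(eqn_pmul2r t0) -[X in (_ * X)%N == _]oS mul_cardG MS oH.
  by rewrite -/U; apply/eqP; lia.
have oN : #|N| = (s * #|U|)%N.
  have NS : N * S = B i.
    by rewrite /N setIC group_modr // MS; apply/setIidPl.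
  apply/eqP; rewrite -(eqn_pmul2r t0) -[X in (_ * X)%N == _]oS mul_cardG NS oB.
  by rewrite -setIA (setIidPr (sSB i)) -/U; apply/eqP; lia.
(* The [M]-class of [m] lies in [m U], so ['C_M[m]] has order at least [s^2], which already bounds
   the order of ['C_H[m]]. *)
have centM m : m \in N -> m \notin S -> 'C_H[m] \subset M.
  case/setIP=> Mm Bm Sm; have Hm := subsetP sMH m Mm.
  have cls : m ^: M \subset m *: U.
    apply/subsetP=> _ /imsetP[g Mg ->]; apply/lcosetP; exists (m^-1 * m ^ g);
      last by rewrite mulKVg.
    rewrite inE groupM ?groupV ?groupJ //=.
    have sder : [~: H, H] \subset S.
      by rewrite -quotient_cents2 ?normal_norm //; apply: skew_quotient_abelian.
    by apply: (subsetP sder); apply: mem_commg => //; apply: (subsetP sMH).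
  have := subset_leq_card cls; rewrite card_lcoset -index_cent1 => le.
  have := Lagrange (subsetIl M 'C[m]); rewrite oM => L.
  have ge : (s * s <= #|'C_M[m]|)%N.
    by rewrite -(leq_pmul2r u0) -L leq_mul2l le orbT.
  have : 'C_M[m] == 'C_H[m].
    by rewrite eqEcard setSI //= (leq_trans (skew_card_cent1 Bm Sm)).
  by move/eqP<-; apply: subsetIl.
have [sSM | /subsetPn[k Sk Mk]] := boolP (S \subset M).
  by rewrite -MS mulGSid.
have sCN : 'C_N[k] \subset U.
  apply/subsetP=> n /setIP[Nn /cent1P kn].
  have [Mn _] := setIP Nn; rewrite inE Mn /=; apply: contraR Mk => Sn.
  apply: (subsetP (centM n Nn Sn)); rewrite inE (subsetP sSH) //.
  by apply/cent1P.
have orb : k ^: N \subset S :\: M.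
  apply/subsetP=> _ /imsetP[n Nn ->]; have [Mn _] := setIP Nn.
  rewrite inE groupJr // Mk memJ_norm //.
  by apply: (subsetP (normal_norm nSH)); apply: (subsetP sMH).
(* The orbit of [k] has at least [s] elements, but [S :\: M] has only [t - #|U| < t <= s]. *)
have := subset_leq_card orb; rewrite -index_cent1 cardsD (setIC S M) -/U oS => le.
have := Lagrange (subsetIl N 'C[k]); rewrite oN => L.
have les : (s <= #|N : 'C_N[k]|)%N.
  rewrite -(leq_pmul2r u0) -L mulnC leq_mul2l; apply/orP; right.
  exact: subset_leq_card.
have := leq_trans les le; rewrite leqNgt => /negP[].
by apply: leq_trans le_ts; rewrite ltn_subrL u0 t0.
Qed.

End SkewFamily.

(** * Elation groups of generalized quadrangles *)

Section GQFacts.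
Variables (P L : finType) (inc : P -> L -> bool) (s t : nat).
Hypothesis gq : is_GQ inc s t.
Local Notation col := (collinear inc).

Lemma colI p q l : inc p l -> inc q l -> col p q.
Proof. by move=> pl ql; apply/existsP; exists l; rewrite pl. Qed.

Lemma colC p q : col p q = col q p.
Proof. by apply: eq_existsb => l; rewrite andbC. Qed.

Lemma col_refl p : col p p.
Proof.
have : #|[set l | inc p l]| != 0 by case: gq => _ -> _ _.
by rewrite cards_eq0 => /set0Pn[l]; rewrite inE => pl; apply: (colI pl pl).
Qed.

Lemma line_unique p q l m : p != q ->
  inc p l -> inc q l -> inc p m -> inc q m -> l = m.
Proof.
move=> pq pl ql pm qm; case: gq => _ _ /(_ p q pq) /card_le1_eqP le1 _.
by apply: le1; rewrite inE; apply/andP.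
Qed.

Lemma proj_exists p l : ~~ inc p l -> exists q, inc q l && col p q.
Proof.
move=> pl; case: gq => _ _ _ /(_ p l pl) /eqP/cards1P[q E].
by exists q; move/setP: E => /(_ q); rewrite !inE eqxx.
Qed.

Lemma proj_unique p l q r : ~~ inc p l ->
  inc q l -> col p q -> inc r l -> col p r -> q = r.
Proof.
move=> pl ql pq rl pr; case: gq => _ _ _ /(_ p l pl) /eqP/cards1P[u /setP E].
by move: (E q) (E r); rewrite !inE ql pq rl pr => /esym/eqP-> /esym/eqP->.
Qed.

Lemma Aut_GQ_col g p q : g \in Aut_GQ inc -> col p q -> col (g p) (g q).
Proof.
rewrite inE => /forallP gA /existsP[l /andP[pl ql]].
have /existsP[m /forallP gl] := gA l.
by apply: (@colI _ _ m); rewrite (eqP (gl _)).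
Qed.

Lemma exists_other_line p l : (0 < t)%N -> exists2 m, inc p m & m != l.
Proof.
move=> gt0; have : (0 < #|[set m | inc p m] :\ l|)%N.
  have := cardsD1 l [set m | inc p m]; case: gq => _ -> _ _.
  by case: (l \in _) => /=; lia.
by case/card_gt0P=> m; rewrite !inE => /andP[ml pm]; exists m.
Qed.

Lemma exists_other_point p l : (0 < s)%N -> exists2 q, inc q l & q != p.
Proof.
move=> gt0; have : (0 < #|[set q | inc q l] :\ p|)%N.
  have := cardsD1 p [set q | inc q l]; case: gq => -> _ _ _.
  by case: (p \in _) => /=; lia.
by case/card_gt0P=> q; rewrite !inE => /andP[qp ql]; exists q.
Qed.

Lemma exists_line (p : P) : exists l, inc p l.
Proof. by have /existsP[l /andP[pl _]] := col_refl p; exists l. Qed.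

(** Walk from [x] to [z] along [l], then to [y] along another line [m]; the only point of [m]
    collinear with [x] is [z]. *)
Lemma exists_noncol x : (0 < s)%N -> (0 < t)%N -> exists y, ~~ col x y.
Proof.
move=> s0 t0; have [l xl] := exists_line x.
have [z zl zx] := exists_other_point x l s0.
have [m zm ml] := exists_other_line z l t0.
have [y ym yz] := exists_other_point z m s0.
exists y; apply: contra yz => xy; apply/eqP.
apply: (@proj_unique x m) => //; last exact: (colI xl zl).
by apply: contra ml => xm; apply/eqP/(@line_unique x z) => //; rewrite eq_sym.
Qed.

End GQFacts.

(** * The Kantor family of a skew translation generalized quadrangle *)

Section Elation.
Variables (P L : finType) (inc : P -> L -> bool) (s t : nat) (x : P).
Variables (H S : {group {perm P}}).
Hypotheses (s_gt1 : (1 < s)%N) (t_gt1 : (1 < t)%N).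
Hypothesis stgq : is_STGQ inc s t x H S.
Local Notation col := (collinear inc).

Let gq : is_GQ inc s t. Proof. by case: stgq => -[]. Qed.
Let nSH : S <| H. Proof. by case: stgq. Qed.
Let oS : #|S| = t. Proof. by case: stgq. Qed.

Lemma elation_col h p q : h \in H -> col (h p) (h q) = col p q.
Proof.
case: stgq => -[_ /subsetP HA _ _] _ _ _ _ Hh.
apply/idP/idP; last exact: (Aut_GQ_col (HA h Hh)).
have := @Aut_GQ_col _ _ _ h^-1 (h p) (h q) (HA _ (groupVr Hh)).
by rewrite !permK.
Qed.

Lemma elation_line h l p : h \in H -> inc x l -> inc (h p) l = inc p l.
Proof.
by case: stgq => -[_ _ fixl _] _ _ _ _ Hh xl; have /forallP/(_ p)/eqP := fixl h Hh l xl.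
Qed.

(** [x] is the only common point of two lines that [h] stabilizes. *)
Lemma elation_center h : h \in H -> h x = x.
Proof.
move=> Hh; have [l xl] := exists_line gq x.
have [m xm ml] := exists_other_line gq x l (ltnW t_gt1).
apply/eqP; apply: contraNT ml => hx; apply/eqP.
by apply: (line_unique gq hx); rewrite ?elation_line.
Qed.

Lemma elation_aff h y : h \in H -> col x (h y) = col x y.
Proof. by move=> Hh; rewrite -{1}(elation_center Hh) elation_col. Qed.

Lemma elation_trans y z : ~~ col x y -> ~~ col x z -> exists2 h, h \in H & h y = z.
Proof.
case: stgq => -[_ _ _ reg] _ _ _ _ xy xz.
have /eqP/cards1P[h /setP/(_ h)] := reg y z xy xz.
by rewrite !inE eqxx => /andP[Hh /eqP]; exists h.
Qed.

Lemma elation_free y g h : ~~ col x y -> g \in H -> h \in H -> g y = h y -> g = h.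
Proof.
case: stgq => -[_ _ _ reg] _ _ _ _ xy Hg Hh E.
have xgy : ~~ col x (g y) by rewrite elation_aff.
have /eqP/cards1P[k /setP Ek] := reg y (g y) xy xgy.
by move: (Ek g) (Ek h); rewrite !inE Hg Hh E eqxx => /esym/eqP-> /esym/eqP->.
Qed.

Lemma symmetry_fix h y : h \in S -> col x y -> h y = y.
Proof.
case: stgq => _ _ _ _ sym Sh xy.
by have /andP[_ /forallP/(_ y)/implyP/(_ xy)/eqP] := sym h Sh.
Qed.

(** The group consists of permutations of points and has no declared action on lines, hence a
    setwise stabilizer defined by hand. *)
Definition line_stab (l : L) : {set {perm P}} := [set h in H | fixes_line inc h l].

Lemma line_stab_group_set l : group_set (line_stab l).
Proof.
apply/group_setP; split=> [|g h]; rewrite !inE.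
  by rewrite group1; apply/forallP=> p; rewrite perm1.
case/andP=> Hg /forallP fg /andP[Hh /forallP fh]; rewrite groupM //=.
by apply/forallP=> p; rewrite permM (eqP (fh _)) (eqP (fg _)).
Qed.

Canonical line_stab_group l := Group (line_stab_group_set l).

Local Notation I := {l : L | inc x l}.
Variables (y0 : P) (z : I -> P) (ln : I -> L).
Hypotheses (xy0 : ~~ col x y0) (z_in : forall k, inc (z k) (val k)).
Hypotheses (z_ln : forall k, inc (z k) (ln k)) (y0_ln : forall k, inc y0 (ln k)).

Local Notation A := (fun k => line_stab_group (ln k)).
Local Notation B := (fun k => 'C_H[z k | 'P]%G).

Let y0z k : col y0 (z k). Proof. exact: (colI (y0_ln k) (z_ln k)). Qed.

Let zx k : z k != x.
Proof. by apply: contra xy0 => /eqP <-; rewrite colC. Qed.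

Let xln k : ~~ inc x (ln k).
Proof. by apply: contra xy0 => xl; apply: (colI xl (y0_ln k)). Qed.

Let aff_out y (k : I) : ~~ col x y -> ~~ inc y (val k).
Proof. by apply: contra => yk; apply: (colI (valP k) yk). Qed.

Let ln_aff k p : inc p (ln k) -> p != z k -> ~~ col x p.
Proof.
move=> pl; apply: contra => xp; apply/eqP/(proj_unique gq (xln k)) => //.
exact: (colI (valP k) (z_in k)).
Qed.

Let z_lnN i j : i != j -> ~~ inc (z i) (ln j).
Proof.
move=> ij; apply/negP=> zl; case: (eqVneq (z i) (z j)) => [E|/(ln_aff zl)/negP[]].
  have/negP[] := ij; apply/eqP/val_inj/(line_unique gq (zx i)) => //; first exact: (valP i).
    by rewrite E.
  exact: (valP j).
exact: (colI (valP i) (z_in i)).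
Qed.

Lemma mem_point_stab h k : h \in H -> (h \in B k) = (h (z k) == z k).
Proof. by move=> Hh; rewrite inE Hh /=; apply/astab1P/eqP. Qed.

(** [h (z k)] is the unique point of the line [k] collinear with [h y0]. With [mem_line_stab], this
    turns membership in [B k] and [A k] into the position of [h y0], which determines [h]. *)
Lemma point_stab_col h k : h \in H -> col (h y0) (z k) = (h (z k) == z k).
Proof.
move=> Hh; apply/idP/eqP => [c|<-]; last by rewrite elation_col.
apply/(proj_unique gq (aff_out k (_ : ~~ col x (h y0)))) => //.
- by rewrite elation_aff.
- by rewrite elation_line ?z_in ?(valP k).
by rewrite elation_col.
Qed.

Lemma mem_line_stab h k : h \in H -> (h \in A k) = inc (h y0) (ln k).
Proof.
move=> Hh; rewrite inE Hh /=; apply/idP/idP=> [/forallP/(_ y0)/eqP->//|hy].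
have hz : h (z k) = z k.
  by apply/eqP; rewrite -point_stab_col //; apply: (colI hy (z_ln k)).
have : h \in Aut_GQ inc by case: stgq => -[_ /subsetP HA _ _] _ _ _ _; apply: HA.
rewrite inE => /forallP/(_ (ln k))/existsP[m /forallP hm].
have hyz : h y0 != z k.
  by apply: contraNneq (_ : ~~ col x (h y0)) => [->|];
    [exact: (colI (valP k) (z_in k)) | rewrite elation_aff].
have lnm : m = ln k.
  apply: (line_unique gq hyz) => //; first by rewrite (eqP (hm y0)).
  by rewrite -hz (eqP (hm (z k))).
by apply/forallP=> p; rewrite -{1}lnm.
Qed.

Lemma line_stab_sub k : A k \subset B k.
Proof.
apply/subsetP=> h Ah; have Hh : h \in H by move: Ah; rewrite inE => /andP[].
rewrite mem_point_stab // -point_stab_col //; apply: (colI _ (z_ln k)).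
by rewrite -mem_line_stab.
Qed.

Lemma symmetry_sub_point_stab k : S \subset B k.
Proof.
apply/subsetP=> h Sh; rewrite mem_point_stab ?(subsetP (normal_sub nSH)) //.
by rewrite (symmetry_fix Sh) // (colI (valP k) (z_in k)).
Qed.

Lemma point_stab_subH k : B k \subset H.
Proof. exact: subsetIl. Qed.

Lemma orbit_y0_inj : {in H &, injective (fun h : {perm P} => h y0)}.
Proof. by move=> g h Hg Hh; apply: elation_free. Qed.

(** Evaluation at [y0] is a bijection from [A k] onto the points of [ln k] other than [z k]. *)
Lemma card_line_stab k : #|A k| = s.
Proof.
have sAH : {subset A k <= H} by move=> h; rewrite inE => /andP[].
rewrite -(card_in_imset (sub_in2 sAH orbit_y0_inj)).
rewrite (_ : [set _ | _ in _] = [set p | inc p (ln k)] :\ z k).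
  have := cardsD1 (z k) [set p | inc p (ln k)]; rewrite inE z_ln.
  by case: gq => -> _ _ _ [].
apply/setP=> p; rewrite !inE; apply/imsetP/andP=> [[h Ah ->]|[pz pl]].
  have Hh := sAH h Ah; rewrite -mem_line_stab // Ah; split=> //.
  apply: contraNneq (_ : ~~ col x (h y0)) => [->|]; last by rewrite elation_aff.
  exact: (colI (valP k) (z_in k)).
have [h Hh hp] := elation_trans xy0 (ln_aff pl pz).
by exists h => //; rewrite mem_line_stab // hp.
Qed.

(** Both [h y0] and [y0] are projections of [z i] onto [ln j], so they are equal. *)
Lemma point_line_stab_ti i j : i != j -> B i :&: A j = 1.
Proof.
move=> ij; apply/trivgP/subsetP=> h /setIP[Bh Ah].
have Hh := subsetP (point_stab_subH i) h Bh.
rewrite mem_point_stab // -point_stab_col // in Bh; rewrite mem_line_stab // in Ah.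
rewrite inE; apply/eqP/(elation_free xy0) => //; rewrite perm1.
by apply: (proj_unique gq (z_lnN ij)); rewrite // colC.
Qed.

Lemma card_index : #|{: I}| = t.+1.
Proof.
case: gq => _ /(_ x) <- _ _; rewrite card_sig cardsE.
by apply: eq_card.
Qed.

Lemma other_line (i : I) : exists j : I, j != i.
Proof.
have [m xm mi] := exists_other_line gq x (val i) (ltnW t_gt1).
by exists (exist _ m xm); apply: contra mi => /eqP <-.
Qed.

(** The product of [A k] and [S] gives the lower bound. For the upper one, [h y0] lies on one of the
    [t] lines through [z k] other than [k], each with [s] further points. *)
Lemma card_point_stab k : #|B k| = (s * t)%N.
Proof.
apply/eqP; rewrite eqn_leq; apply/andP; split; last first.
  have tiAS : A k :&: S = 1.
    have [j jk] := other_line k; apply/trivgP; rewrite -(point_line_stab_ti jk) setIC.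
    by rewrite setIS // symmetry_sub_point_stab.
  rewrite -(card_line_stab k) -oS -(TI_cardMg tiAS); apply: subset_leq_card.
  by rewrite mul_subG ?line_stab_sub ?symmetry_sub_point_stab.
rewrite -(card_in_imset (sub_in2 (subsetP (point_stab_subH k)) orbit_y0_inj)).
pose F (l : L) := if inc (z k) l && (l != val k) then [set p | inc p l] :\ z k else set0.
apply: (@leq_trans #|\bigcup_l F l|).
  apply/subset_leq_card/subsetP=> _ /imsetP[h Bh ->].
  have Hh := subsetP (point_stab_subH k) h Bh.
  rewrite mem_point_stab // -point_stab_col // in Bh.
  have /existsP[l /andP[hl zl]] := Bh.
  have hx : ~~ col x (h y0) by rewrite elation_aff.
  apply/bigcupP; exists l => //; rewrite /F zl /=.
  rewrite (_ : l != val k); last by apply: contraNneq (aff_out k hx) => <-.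
  rewrite !inE hl andbT; apply: contraNneq hx => ->.
  exact: (colI (valP k) (z_in k)).
have le_big : (#|\bigcup_l F l| <= \sum_l #|F l|)%N.
  by elim/big_rec2: _ => [|l n U _ le]; rewrite ?cards0 //
    (leq_trans (leq_card_setU _ _)) // leq_add2l.
apply: leq_trans le_big _.
rewrite (bigID (fun l => inc (z k) l && (l != val k))) /= [X in (_ + X)%N]big1; last first.
  by move=> l /negbTE nl; rewrite /F nl cards0.
rewrite addn0 (eq_bigr (fun=> s)); last first.
  move=> l nl; have := cardsD1 (z k) [set p | inc p l]; rewrite /F nl inE.
  by case/andP: nl => -> _; case: gq => -> _ _ _ [].
rewrite sum_nat_const mulnC leq_mul2l; apply/orP; right.
have := cardsD1 (val k) [set l | inc (z k) l]; rewrite inE z_in.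
case: gq => _ -> _ _ [->]; apply/subset_leq_card/subsetP=> l.
by rewrite unfold_in !inE andbC.
Qed.

Lemma orbit_point_sub k : orbit 'P H (z k) \subset [set p | inc p (val k)] :\ x.
Proof.
apply/subsetP=> _ /orbitP[h Hh <-]; rewrite !inE /= /aperm.
rewrite elation_line ?(valP k) // z_in andbT.
by apply: contra (zx k) => /eqP E; apply/eqP/(@perm_inj _ h); rewrite E elation_center.
Qed.

Lemma card_line_minus (k : I) : #|[set p | inc p (val k)] :\ x| = s.
Proof.
have := cardsD1 x [set p | inc p (val k)]; rewrite inE (valP k).
by case: gq => -> _ _ _ [].
Qed.

(** The upper bound comes from the orbit of [z i], of size at most [s]; the lower one from the
    product of [B j] and [A i]. *)
Lemma card_elation_group : #|H| = (s * s * t)%N.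
Proof.
have /card_gt0P[i _] : (0 < #|{: I}|)%N by rewrite card_index.
have [j ji] := other_line i.
apply/eqP; rewrite eqn_leq; apply/andP; split.
  rewrite -(Lagrange (point_stab_subH i)) card_point_stab -card_orbit.
  have := subset_leq_card (orbit_point_sub i); rewrite card_line_minus => le.
  by rewrite (mulnC _ #|_|) -mulnA leq_mul2r le orbT.
have ti := point_line_stab_ti ji.
have : (#|(B j * A i)%g| <= #|H|)%N.
  by apply/subset_leq_card; rewrite mul_subG ?point_stab_subH //
    (subset_trans (line_stab_sub i)) ?point_stab_subH.
by rewrite (TI_cardMg ti) card_point_stab card_line_stab; lia.
Qed.

Lemma elation_line_trans k p : inc p (val k) -> p != x -> exists2 h, h \in H & h (z k) = p.
Proof.
move=> pk px; suff : p \in orbit 'P H (z k) by case/orbitP=> h Hh <-; exists h.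
have /eqP-> : orbit 'P H (z k) == [set p | inc p (val k)] :\ x; last by rewrite !inE px.
rewrite eqEcard orbit_point_sub card_line_minus card_orbit.
rewrite -divgS ?point_stab_subH // card_elation_group card_point_stab.
by rewrite -mulnA mulnK ?muln_gt0 ?(ltnW s_gt1) ?(ltnW t_gt1) ?leqnn.
Qed.

Lemma property_star_normal : property_star inc x H -> forall k, B k <| H.
Proof.
move=> star k; rewrite /normal point_stab_subH; apply/subsetP=> g Hg.
rewrite inE; apply/subsetP=> _ /imsetP[h Bh ->].
have Hh := subsetP (point_stab_subH k) h Bh.
rewrite mem_point_stab ?groupJ // conjgE !permM.
rewrite mem_point_stab // in Bh.
(* By the star property [h] fixes the whole line [k], in particular the image of [z k] under
   [g^-1]. *)
rewrite (star (z k) (zx k) _ h Hh (eqP Bh) (val k) (valP k) (z_in k)) ?permKV //.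
  exact: (colI (valP k) (z_in k)).
by rewrite elation_line ?groupV ?(valP k).
Qed.

Hypothesis nB : forall k, B k <| H.
Hypothesis ndvd : ~~ (s + t %| s * t)%N.

Let mem_point_stabJ h g k : h \in H -> g \in H -> (h ^ g \in B k) = (h \in B k).
Proof. by move=> Hh Hg; rewrite memJ_norm // (subsetP (normal_norm (nB k))). Qed.

(** [H] is transitive on the points of [k] other than [x], so their stabilizers are conjugate to
    [B k], which is normal. *)
Lemma point_stab_fix_line h k p : h \in H -> inc p (val k) -> p != x ->
  (h p == p) = (h \in B k).
Proof.
move=> Hh pk px; have [g Hg <-] := elation_line_trans pk px.
rewrite -(@mem_point_stabJ h g^-1) ?groupV // mem_point_stab ?groupJ ?groupV //.
by rewrite conjgE invgK !permM -[RHS](inj_eq (@perm_inj _ g)) permKV.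
Qed.

(* Otherwise h moves every point not collinear with x to a non-collinear one, and
   Benson's congruence for h reads s + t %| s t. *)
Lemma point_stab_conj k h : h \in B k -> h \notin S ->
  exists2 g, g \in H & h ^ g \in A k.
Proof.
move=> Bh Sh; have Hh := subsetP (point_stab_subH k) h Bh.
apply/exists_inP; apply: contraR ndvd => /exists_inPn noconj.
pose F p := joins inc p (h p).
have F_aff p : ~~ col x p -> F p = 0%N.
  move=> xp; have [g Hg gp] := elation_trans xy0 xp.
  have hp : h p != p.
    apply: contraNneq Sh => hp; rewrite (_ : h = 1) ?group1 //.
    by apply: (elation_free xp); rewrite ?perm1.
  rewrite /F (joins_neq gq) 1?eq_sym //; apply/eqP; rewrite eqb0.
  have Vg := groupVr Hg; apply: contra (noconj _ Vg) => cp.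
  have hJ : (h ^ g^-1) y0 = g^-1 (h p) by rewrite conjgE invgK !permM gp.
  have HJ : h ^ g^-1 \in H by rewrite groupJ.
  rewrite mem_line_stab // hJ.
  have y0p : y0 = g^-1 p by rewrite -gp permK.
  have /existsP[m /andP[y0m hm]] : col y0 (g^-1 (h p)) by rewrite y0p elation_col.
  (* Otherwise [y0] and its image under [h ^ g^-1] would both be the projection of [z k] onto [m],
     and [h] would fix [p]. *)
  have zm : inc (z k) m.
    apply: contraR hp => zm; rewrite -(inj_eq (@perm_inj _ g^-1)) -y0p; apply/eqP.
    apply: (proj_unique gq zm); rewrite // colC //.
    by rewrite -hJ point_stab_col // -mem_point_stab // mem_point_stabJ.
  rewrite -(@line_unique _ _ _ _ _ gq y0 (z k) m (ln k)) //.
  by apply: contraNneq xy0 => ->; apply: (colI (valP k) (z_in k)).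
(* On [k] every point is fixed; on another line through [x] every point except [x] moves along that
   line, as [h] is outside [S]. *)
have F_line l : inc x l ->
    (\sum_(p | inc p l && (p != x)) F p = s * (if l == val k then t.+1 else 1))%N.
  move=> xl; pose j : I := exist _ l xl.
  rewrite (eq_bigr (fun=> if l == val k then t.+1 else 1%N)).
    rewrite sum_nat_const; congr (_ * _)%N; rewrite -(card_line_minus j).
    by apply: eq_card => p; rewrite unfold_in !inE andbC.
  move=> p /andP[pl px]; rewrite /F.
  have := @point_stab_fix_line h j p Hh pl px.
  case: (l =P val k) => [lk|lk] hpE.
    have jk : j = k by apply: val_inj.
    by move: hpE; rewrite jk Bh => /eqP->; rewrite (joins_diag gq).
  have hp : h p != p.
    rewrite hpE; apply: contra Sh => Bj.
    have jk : j != k by apply: contra_not_neq lk => <-.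
    rewrite -(skew_tiBB t_gt1 card_index oS card_line_stab card_point_stab line_stab_sub
      symmetry_sub_point_stab point_line_stab_ti jk); exact/setIP.
  rewrite (joins_neq gq) 1?eq_sym // (colI pl) //.
  by rewrite elation_line.
have F_sum : (\sum_p F p = s.+1 * t.+1 + s * t)%N.
  rewrite (bigD1 x) //= {1}/F elation_center // (joins_diag gq).
  (* A point other than [x] lies on one line through [x] if it is collinear with [x]; otherwise it
     contributes 0. *)
  have -> : (\sum_(p | p != x) F p =
      \sum_(l | inc x l) \sum_(p | inc p l && (p != x)) F p)%N.
    rewrite (exchange_big_dep (fun p => p != x)) /=; last by move=> l p _ /andP[].
    apply: eq_bigr => p px; rewrite sum_nat_const.
    rewrite (_ : #|_| = joins inc x p); last first.
      by apply: eq_card => l; rewrite unfold_in inE px andbT.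
    rewrite (joins_neq gq) 1?eq_sym //.
    by case: (boolP (col x p)) => [_|/F_aff->]; rewrite ?mul1n.
  rewrite (eq_bigr _ F_line) -big_distrr /= (bigD1 (val k)) ?(valP k) //= eqxx.
  rewrite (eq_bigr (fun=> 1%N)); last by move=> l /andP[_ /negbTE->].
  rewrite sum1_card (_ : #|_| = t); first by lia.
  have := cardsD1 (val k) [set l | inc x l]; rewrite inE (valP k).
  case: gq => _ -> _ _ [->]; apply: eq_card => l.
  by rewrite unfold_in !inE andbC.
have := benson gq (fun p q => elation_col p q Hh) x (ltnW s_gt1).
rewrite F_sum => /eqP; rewrite -{2}[(s.+1 * t.+1)%N]addn0 eqn_modDl mod0n.
by [].
Qed.

End Elation.

(** * Applying the group theory to the quadrangle *)

Theorem mainTheorem17 (P L : finType) (inc : P -> L -> bool) (s t : nat)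
  (x : P) (H S : {group {perm P}}) :
  thick_GQ inc s t ->
  is_STGQ inc s t x H S ->
  ((s = t /\ odd s) \/ (s <> t /\ property_star inc x H)) ->
  forall M : {group {perm P}}, M \subset H -> (M * S)%g = H :> {set {perm P}} ->
  M = H :> {set {perm P}}.
Proof.
move=> [gq s_gt1 t_gt1] stgq cases.
have s0 := ltnW s_gt1; have t0 := ltnW t_gt1.
have [y0 xy0] := exists_noncol gq x s0 t0.
have /fin_all_exists[z zP] (k : {l | inc x l}) : exists q, inc q (val k) && collinear inc y0 q.
  apply: (proj_exists gq); apply: contra xy0 => y0k; exact: (colI (valP k) y0k).
have /fin_all_exists[ln lnP] (k : {l | inc x l}) : exists l, inc y0 l && inc (z k) l.
  by apply/existsP; case/andP: (zP k).
have z_in k : inc (z k) (val k) by case/andP: (zP k).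
have y0_ln k : inc y0 (ln k) by case/andP: (lnP k).
have z_ln k : inc (z k) (ln k) by case/andP: (lnP k).
have cI := card_index stgq.
have [nSH oS] : S <| H /\ #|S| = t by case: stgq.
have oH := card_elation_group s_gt1 t_gt1 stgq xy0 z_in z_ln y0_ln.
have oA := card_line_stab t_gt1 stgq xy0 z_in z_ln y0_ln.
have oB := card_point_stab t_gt1 stgq xy0 z_in z_ln y0_ln.
have sAB := line_stab_sub t_gt1 stgq xy0 z_in z_ln y0_ln.
have sSB := symmetry_sub_point_stab stgq z_in.
have sBH k : 'C_H[z k | 'P]%G \subset H by apply: subsetIl.
have ti := point_line_stab_ti t_gt1 stgq xy0 z_in z_ln y0_ln.
have nB : forall k, 'C_H[z k | 'P]%G <| H.
  case: cases => [[st _]|[_ star]].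
    exact: (skew_normal_square s_gt1 t_gt1 cI nSH oH oS oA oB sAB sSB sBH ti st).
  exact: (property_star_normal stgq xy0 z_in z_ln y0_ln star).
have part := skew_leq_part s_gt1 t_gt1 cI nSH oH oS oA oB sAB sSB sBH ti nB.
have ndvd : ~~ (s + t %| s * t)%N.
  case: cases => [[<- os]|[/eqP st _]]; last exact: not_dvdn_add_mul.
  (* For [s = t], divisibility of [s^2] by [2s] would make [s] even. *)
  by rewrite addnn -muln2 dvdn_pmul2l // dvdn2 os.
have le_ts : (t <= s)%N.
  apply: leq_trans (part _ (pdiv_prime s_gt1) (pdiv_dvd s)) _.
  by apply: dvdn_leq; rewrite // dvdn_part.
apply: (skew_supplement s_gt1 t_gt1 cI nSH oH oS oA oB sAB sSB sBH ti nB le_ts) => k h.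
exact: (point_stab_conj s_gt1 t_gt1 stgq xy0 z_in z_ln y0_ln nB ndvd).
Qed.
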